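(* Let $\mathfrak{g}$ be a real, compact, semisimple Lie algebra, equipped with its Killing form $B$. Then the diagonal $\Delta=\{(x,x)\mid x\in\mathfrak{g}\}$ in $\mathfrak{g}\oplus\bar{\mathfrak{g}}$ does not admit a Dirac complement.
   Context: Lie algebras are finite-dimensional, and semisimple Lie algebras are nonzero by convention. $\bar{\mathfrak{g}}$ denotes the Lie algebra $\mathfrak{g}$ with pairing $-B$, and $\mathfrak{g}\oplus\bar{\mathfrak{g}}$ is the orthogonal direct sum, with pairing $\langle(x,y),(x',y')\rangle=B(x,x')-B(y,y')$ and componentwise bracket; it is a quadratic Lie algebra (a Courant algebroid over a point). In a quadratic Lie algebra $E$, a Dirac structure is a lagrangian subalgebra, i.e. a Lie subalgebra $L$ with $L=L^\perp$; a Dirac complement of $L$ is a Dirac structure $M$ with $L\oplus M=E$ as vector spaces. The diagonal $\Delta$ is a Dirac structure in $\mathfrak{g}\oplus\bar{\mathfrak{g}}$. *)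

(* Defs.v *)
From HB Require Import structures.
From mathcomp Require Import all_boot all_order all_algebra.
From mathcomp Require Import reals.

Set Implicit Arguments.
Unset Strict Implicit.
Unset Printing Implicit Defensive.

Import Order.TTheory GRing.Theory Num.Theory.
Local Open Scope ring_scope.

Section LfunTrace.
Variables (K : fieldType) (vT : vectType K).
Implicit Types f h : 'End(vT).

Let b := vbasis {:vT}.

(* By lfun_trace_basis below, the choice of basis is irrelevant. *)
Definition lfun_trace f : K := \tr (passmx.mxof b b f).

Let bP : basis_of {:vT} b := vbasisP _.

Lemma lfun_traceC f h : lfun_trace (f \o h)%VF = lfun_trace (h \o f)%VF.
Proof. by rewrite /lfun_trace !(passmx.mxof_comp _ _ bP) mxtrace_mulC. Qed.

Fact lfun_trace_scalar : scalar lfun_trace.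
Proof. by move=> a f h; rewrite /lfun_trace passmx.mxof_linear mxtraceD mxtraceZ. Qed.

HB.instance Definition _ :=
  GRing.isLinear.Build K 'End(vT) K *%R lfun_trace lfun_trace_scalar.

Lemma lfun_trace_basis (e : (\dim {:vT}).-tuple vT) f :
  basis_of {:vT} e -> lfun_trace f = \tr (passmx.mxof e e f).
Proof.
move=> eP; rewrite /lfun_trace -[in LHS](comp_lfun1l f) -[in RHS](comp_lfun1r f).
by rewrite (passmx.mxof_comp _ _ eP) (passmx.mxof_comp _ _ bP) mxtrace_mulC.
Qed.

End LfunTrace.

HB.mixin Record Vector_isLieAlgebra (K : fieldType) g of Vector K g := {
  lie : g -> g -> g;
  lie_linearl : forall y, linear (lie^~ y);
  lie_linearr : forall x, linear (lie x);
  lie_alternating : forall x, lie x x = 0;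
  lie_jacobi : forall x y z,
    lie x (lie y z) + lie y (lie z x) + lie z (lie x y) = 0
}.

#[short(type="lieAlgType")]
HB.structure Definition LieAlgebra (K : fieldType) :=
  {g of Vector_isLieAlgebra K g & Vector K g}.

HB.instance Definition _ (K : fieldType) (g : lieAlgType K) :=
  bilinear_isBilinear.Build K g g g
    (GRing.Scale.Law.clone _ _ *:%R _) (GRing.Scale.Law.clone _ _ *:%R _)
    (@lie K g) (pair (@lie_linearl K g) (@lie_linearr K g)).

HB.instance Definition _ (K : fieldType) (g : lieAlgType K) (x : g) :=
  GRing.isLinear.Build K g g *:%R (lie x) (lie_linearr x).

Section DirectSum.
Variables (K : fieldType) (g h : lieAlgType K).

Definition pair_lie (u v : g * h) : g * h := (lie u.1 v.1, lie u.2 v.2).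

Fact pair_lie_linearl v : linear (pair_lie^~ v).
Proof. by move=> a x y; congr (_, _); rewrite /= linearPl. Qed.

Fact pair_lie_linearr u : linear (pair_lie u).
Proof. by move=> a x y; congr (_, _); rewrite /= linearPr. Qed.

Fact pair_lie_alternating u : pair_lie u u = 0.
Proof. by congr (_, _); exact: lie_alternating. Qed.

Fact pair_lie_jacobi u v w :
  pair_lie u (pair_lie v w) + pair_lie v (pair_lie w u)
    + pair_lie w (pair_lie u v) = 0.
Proof. by congr (_, _); exact: lie_jacobi. Qed.

HB.instance Definition _ := Vector_isLieAlgebra.Build K (g * h)%type
  pair_lie_linearl pair_lie_linearr pair_lie_alternating pair_lie_jacobi.

End DirectSum.

Section LieTheory.
Variables (K : fieldType) (g : lieAlgType K).
Implicit Types (U V W I L : {vspace g}) (x y z : g).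

Definition subalgebra L := {in L &, forall x y, lie x y \in L}.

Definition ideal I := forall x, {in I, forall y, lie x y \in I}.

(* [U, V], the span of all brackets; by bilinearity bases suffice. *)
Definition lie_prod U V : {vspace g} :=
  <<[seq lie u v | u <- vbasis U, v <- vbasis V]>>%VS.

Definition derived_series n U := iter n (fun W => lie_prod W W) U.

Definition solvable U := exists n, derived_series n U = 0%VS.

(* Zero radical; semisimple Lie algebras are nonzero by convention. *)
Definition semisimple :=
  (fullv : {vspace g}) <> 0%VS /\
  forall I, ideal I -> solvable I -> I = 0%VS.

Definition ad x : 'End(g) := linfun (lie x).

Definition killing x y : K := lfun_trace (ad x \o ad y)%VF.

Definition invariant (B : g -> g -> K) :=
  forall x y z, B (lie x y) z = - B y (lie x z).

Lemma lie_prodP U V W :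
  reflect {in U & V, forall u v, lie u v \in W} (lie_prod U V <= W)%VS.
Proof.
apply: (iffP span_subvP) => [sUVW u v Uu Vv | sUVW w].
  rewrite (coord_vbasis Uu) (coord_vbasis Vv) linear_sumlz memv_suml // => i _.
  rewrite linear_sumr memv_suml // => j _.
  rewrite linearZl_LR linearZr_LR !memvZ //.
  by apply: sUVW; apply: allpairs_f; rewrite mem_nth ?size_tuple.
by case/allpairsP=> -[u v] /= [Uu Vv ->]; apply: sUVW; exact: vbasis_mem.
Qed.

End LieTheory.

Section Killing.
Variables (K : fieldType) (g : lieAlgType K).
Implicit Types x y : g.

Lemma adE x y : ad x y = lie x y. Proof. by rewrite lfunE. Qed.

Lemma killingC x y : killing x y = killing y x.
Proof. exact: lfun_traceC. Qed.

Fact killing_scalarr x : scalar (killing x).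
Proof.
move=> a y z; rewrite /killing -linearP; congr lfun_trace; apply/lfunP => w.
rewrite !(comp_lfunE, add_lfunE, scale_lfunE, adE).
by rewrite linearPl linearPr.
Qed.

Fact killing_scalarl y : scalar ((@killing K g)^~ y).
Proof. by move=> a x z; rewrite /= !(killingC _ y) killing_scalarr. Qed.

HB.instance Definition _ := bilinear_isBilinear.Build K g g K
  (GRing.Scale.Law.clone _ _ *%R _) (GRing.Scale.Law.clone _ _ (idfun \; *%R) _)
  (@killing K g) (pair killing_scalarl killing_scalarr).

Fact killing_symmetric x y : killing x y = (-1) ^+ false * idfun (killing y x).
Proof. by rewrite mul1r killingC. Qed.

HB.instance Definition _ := isHermitianSesquilinear.Build K g false idfun
  (@killing K g) killing_symmetric.

End Killing.

Section OppForm.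
Variables (K : fieldType) (V : vectType K) (B : {symmetric V}).

Definition opp_form (x y : V) : K := - B x y.

Fact opp_form_scalarl y : scalar (opp_form^~ y).
Proof. by move=> a x z; rewrite /opp_form linearPl /= opprD mulrN. Qed.

Fact opp_form_scalarr x : scalar (opp_form x).
Proof. by move=> a y z; rewrite /opp_form linearPr /= opprD mulrN. Qed.

HB.instance Definition _ := bilinear_isBilinear.Build K V V K
  (GRing.Scale.Law.clone _ _ *%R _) (GRing.Scale.Law.clone _ _ (idfun \; *%R) _)
  opp_form (pair opp_form_scalarl opp_form_scalarr).

Fact opp_form_symmetric x y : opp_form x y = (-1) ^+ false * idfun (opp_form y x).
Proof. by rewrite mul1r /opp_form (hermC B) mul1r. Qed.

HB.instance Definition _ := isHermitianSesquilinear.Build K V false idfun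
  opp_form opp_form_symmetric.

End OppForm.

Section SumForm.
Variables (K : fieldType) (V W : vectType K).
Variables (B : {symmetric V}) (C : {symmetric W}).

Definition sum_form (u v : V * W) : K := B u.1 v.1 + C u.2 v.2.

Fact sum_form_scalarl v : scalar (sum_form^~ v).
Proof. by move=> a x y; rewrite /sum_form !linearPl /= mulrDr addrACA. Qed.

Fact sum_form_scalarr u : scalar (sum_form u).
Proof. by move=> a x y; rewrite /sum_form !linearPr /= mulrDr addrACA. Qed.

HB.instance Definition _ := bilinear_isBilinear.Build K (V * W)%type (V * W)%type K
  (GRing.Scale.Law.clone _ _ *%R _) (GRing.Scale.Law.clone _ _ (idfun \; *%R) _)
  sum_form (pair sum_form_scalarl sum_form_scalarr).

Fact sum_form_symmetric u v : sum_form u v = (-1) ^+ false * idfun (sum_form v u).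
Proof. by rewrite mul1r /sum_form (hermC B) (hermC C) !mul1r. Qed.

HB.instance Definition _ := isHermitianSesquilinear.Build K (V * W)%type false idfun
  sum_form sum_form_symmetric.

End SumForm.

Section Dirac.
Variables (K : fieldType) (E : lieAlgType K) (B : {symmetric E}).
Implicit Types L M : {vspace E}.

Definition dirac L := subalgebra L /\ L = orthov B L.

Definition dirac_complement L M :=
  [/\ dirac M, directv (L + M) & (L + M)%VS = fullv].

End Dirac.

Section Double.
Variables (K : fieldType) (g : lieAlgType K).

Definition double_pairing : {symmetric (g * g)%type} :=
  sum_form (@killing K g) (opp_form (@killing K g)).

Definition diagonal : {vspace g * g} := limg (linfun (fun x : g => (x, x))).

Lemma double_pairingE u v :
  double_pairing u v = killing u.1 v.1 - killing u.2 v.2.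
Proof. by []. Qed.

Lemma mem_diagonal u : (u \in diagonal) = (u.1 == u.2).
Proof.
have diag_linear : linear (fun x : g => (x, x)) by [].
pose dL := GRing.isLinear.Build _ _ _ _ _ diag_linear.
pose d : {linear g -> (g * g)%type} := HB.pack (fun x : g => (x, x)) dL.
apply/memv_imgP/eqP => [[x _ ->] | ]; first by rewrite (lfunE d).
by case: u => x y /= <-; exists x; rewrite ?memvf // (lfunE d).
Qed.

End Double.

(* Existence of an ad-invariant inner product is the intrinsic form of being the
   Lie algebra of a compact Lie group; no sign of the Killing form is assumed. *)
Definition compact_lie (R : realType) (g : lieAlgType R) :=
  exists f : {dot g for idfun}, invariant f.

(* Main.v *)
(* Compactness and semisimplicity make the Killing form negative definite. A Dirac
   complement M of the diagonal then meets 0 x g trivially (it is isotropic), so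
   it is the graph of an isometric automorphism h of g, and h has no nonzero
   fixed vector because M meets the diagonal trivially. Such an h cannot exist.
   Choose an eigenvalue exp(i alpha) of h with alpha in (0, pi] minimal, on a
   plane spanned by a and b. The bracket [a,b] is fixed by h, so it is 0 and
   ad a, ad b commute. If they do not both vanish, let exp(i beta) be an
   eigenvalue of h with beta in [0, pi] minimal on K = im (ad a) + im (ad b);
   bracketing the corresponding vectors with a and b produces in K the eigenvalue
   exp(i (beta - alpha)), which is closer to 1, a contradiction. Hence a is
   central, and g has no center. *)
From HB Require Import structures.
From mathcomp Require Import all_boot all_order all_algebra.
From mathcomp Require Import reals classical_sets topology normedtype derive.
From mathcomp Require Import ring lra.
Require Import Defs.
Import Order.TTheory GRing.Theory Num.Theory.
Import numFieldNormedType.Exports.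
Local Open Scope ring_scope.

Set Implicit Arguments.
Unset Strict Implicit.
Unset Printing Implicit Defensive.

(** * Rewriting rules for linear maps and symmetric forms *)

Section Lfun.
Variables (K : fieldType) (U V : vectType K) (h : 'Hom(U, V)).

Lemma lfunD x y : h (x + y) = h x + h y. Proof. exact: linearD. Qed.
Lemma lfunZ a x : h (a *: x) = a *: h x. Proof. exact: linearZ. Qed.
Lemma lfunB x y : h (x - y) = h x - h y. Proof. exact: linearB. Qed.
Lemma lfunN x : h (- x) = - h x. Proof. exact: linearN. Qed.

End Lfun.

Section Forms.
Variables (R : realType) (V : vectType R) (f : {symmetric V}).

Lemma symC x y : f x y = f y x.
Proof. by rewrite (hermC f) mul1r. Qed.

Lemma symDl x y z : f (x + y) z = f x z + f y z.
Proof. by rewrite linearDl. Qed.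

Lemma symZl a x z : f (a *: x) z = a * f x z.
Proof. by rewrite linearZl_LR. Qed.

Lemma symNl x z : f (- x) z = - f x z.
Proof. by rewrite linearNl. Qed.

Lemma symNr x z : f z (- x) = - f z x.
Proof. by rewrite linearNr. Qed.

Lemma sym0r z : f z 0 = 0.
Proof. by rewrite linear0r. Qed.

Lemma symDr x y z : f z (x + y) = f z x + f z y.
Proof. by rewrite linearDr. Qed.

Lemma symZr a x z : f z (a *: x) = a * f z x.
Proof. by rewrite linearZr_LR. Qed.

Lemma sym_suml I r (P : pred I) E z :
  f (\sum_(i <- r | P i) E i) z = \sum_(i <- r | P i) f (E i) z.
Proof. exact: linear_sumlz. Qed.

Lemma sym_sumr I r (P : pred I) E z :
  f z (\sum_(i <- r | P i) E i) = \sum_(i <- r | P i) f z (E i).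
Proof. exact: linear_sumr. Qed.

(** In coordinates this is a quadratic polynomial; it makes the Rayleigh quotient below
    continuous. *)
Lemma continuous_bilinear_coord n (b : 'I_n -> V) (h : 'End(V)) :
  continuous (fun v : 'rV[R]_n =>
    f (h (\sum_i v 0 i *: b i)) (\sum_i v 0 i *: b i)).
Proof.
have -> : (fun v : 'rV[R]_n =>
      f (h (\sum_i v 0 i *: b i)) (\sum_i v 0 i *: b i)) =
    (fun v => \sum_i \sum_j (v 0 i * v 0 j * f (h (b i)) (b j))).
  apply/boolp.funext => v; rewrite (linear_sum h) sym_suml.
  apply: eq_bigr => i _; rewrite sym_sumr; apply: eq_bigr => j _ /=.
  by rewrite lfunZ symZl symZr mulrA.
apply: continuous_big; first exact: add_continuous.
move=> i _ /=.
apply: continuous_big; first exact: add_continuous.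
move=> j _ v.
have c k : continuous (fun v : 'rV[R]_n => v 0 k) by exact: coord_continuous.
by apply: (continuousM (continuousM (c i v) (c j v))); exact: cst_continuous.
Qed.

End Forms.

(** First-order condition at a minimum: the expression is minimal at [t = 0], so its slope there
    vanishes. *)
Lemma linear_coeff_eq0 (R : realFieldType) (b d : R) :
  (forall t, 0 <= t * b + t ^+ 2 * d) -> b = 0.
Proof.
move=> H; apply/eqP; rewrite -sqrf_eq0 eq_le sqr_ge0 andbT.
pose e := (`|d| + 1)^-1.
have d1 : 0 < `|d| + 1 by rewrite ltr_wpDl.
have e0 : 0 < e by rewrite invr_gt0.
have ed : e * d < 1.
  rewrite mulrC ltr_pdivrMr // mul1r.
  by apply: le_lt_trans (ler_norm d) _; rewrite ltrDl.
(* A small step downhill: as [e * d < 1], the value is a negative multiple of [b ^+ 2]. *)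
have := H (- (b * e)).
have -> : - (b * e) * b + (- (b * e)) ^+ 2 * d = b ^+ 2 * (e * (e * d - 1)).
  by ring.
rewrite nmulr_lge0 //.
by rewrite pmulr_rlt0 // subr_lt0.
Qed.

(** * Rayleigh quotients and isometries of a Euclidean space *)

Section Euclidean.
Variables (R : realType) (V : vectType R) (f : {symmetric V}).
Hypothesis f_gt0 : forall x : V, x != 0 -> 0 < f x x.

Lemma sym_ge0 x : 0 <= f x x.
Proof.
by have [->|/f_gt0/ltW//] := eqVneq x 0; rewrite sym0r.
Qed.

Lemma sym_eq0 x : f x x = 0 -> x = 0.
Proof. by move=> fx; have [//|/f_gt0] := eqVneq x 0; rewrite fx ltxx. Qed.

(** The quotient [f (h w) w / f w w] attains a maximum [c] on [K], at [y]. The third clause is the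
    vanishing of its first variation there: tested against [K], [y] is an eigenvector of the
    symmetric part of [h]. *)
Lemma rayleigh_max (h : 'End(V)) (K : {vspace V}) : K != 0%VS ->
  exists y c, [/\ y \in K, y != 0,
    {in K, forall w, f (h y) w + f y (h w) = 2 * c * f y w}
    & {in K, forall w, f (h w) w <= c * f w w}].
Proof.
move=> K0; pose b := vbasis K.
pose phi (v : 'rV[R]_(\dim K)) := \sum_i v 0 i *: b`_i.
have phiK v : phi v \in K.
  by apply: memv_suml => i _; rewrite memvZ // vbasis_mem // mem_nth // size_tuple.
have phi_surj w : w \in K -> exists v, w = phi v.
  move=> /coord_vbasis ->; exists (\row_i coord (vbasis K) i w).
  by apply: eq_bigr => i _; rewrite mxE.
have phi0 v : phi v = 0 -> v = 0.
  move=> /freeP-/(_ (basis_free (vbasisP K))) v0; apply/rowP => i.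
  by rewrite mxE v0.
have phiZ a v : phi (a *: v) = a *: phi v.
  by rewrite scaler_sumr; apply: eq_bigr => i _; rewrite mxE scalerA.
(* The sphere of the norm on row vectors, not of [f]: it is compact, and the quotient is invariant
   under scaling. *)
pose A := [set v : 'rV[R]_(\dim K) | `|v| = 1]%classic.
have A_n0 v : A v -> phi v != 0.
  move=> Av; apply/eqP => /phi0 v0; move: Av; rewrite /A /= v0 normr0 => /eqP.
  by rewrite eq_sym oner_eq0.
have norm_A w : w \in K -> w != 0 ->
    exists a v, [/\ a != 0, A v & w = a *: phi v].
  move=> /phi_surj[v ->] pv0.
  have v0 : v != 0.
    by apply: contraNneq pv0 => ->; rewrite -(scale0r 0) phiZ scale0r.
  exists `|v|, (`|v|^-1 *: v); split; first by rewrite normr_eq0.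
    by rewrite /A /= normrZ normfV normr_id mulVf // normr_eq0.
  by rewrite phiZ scalerA divff ?scale1r // normr_eq0.
pose rho v := f (h (phi v)) (phi v) / f (phi v) (phi v).
have [|||v0 + max_v0] := @EVT_max_rV R _ rho A.
- have [w [wK w0]] : exists w, w \in K /\ w != 0.
    by exists (vpick K); rewrite memv_pick vpick0.
  by have [a [v [_ Av _]]] := norm_A w wK w0; exists v.
- apply: bounded_closed_compact.
    exists 1; split=> [|M M1 v]; first exact: num_real.
    by rewrite /A /= => ->; exact: ltW.
  apply: (@closed_comp _ _ (fun v : 'rV[R]_(\dim K) => `|v|) [set 1]%classic).
    by move=> v _; exact: norm_continuous.
  exact: closed_eq.
- apply: continuous_in_subspaceT => v /set_mem Av.
  have cphi (k : 'End(V)) :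
      continuous (fun v : 'rV[R]_(\dim K) => f (k (phi v)) (phi v)).
    exact: (@continuous_bilinear_coord _ _ f _ (fun i : 'I_(\dim K) => b`_i) k).
  have cphi1 : continuous (fun v => f (phi v) (phi v)).
    have -> : (fun v => f (phi v) (phi v)) =
        (fun v => f (\1%VF (phi v)) (phi v)).
      by apply/boolp.funext => w; rewrite id_lfunE.
    exact: cphi.
  apply: (continuousM (cphi h v)); apply: continuousV; last exact: cphi1.
  by rewrite gt_eqF // f_gt0 // A_n0.
move=> /set_mem Av0.
have y0 := A_n0 _ Av0; set y := phi v0 in y0.
have fy : f y y != 0 by rewrite gt_eqF // f_gt0.
exists y, (rho v0).
have max_c : {in K, forall w, f (h w) w <= rho v0 * f w w}.
  move=> w wK; have [->|w0] := eqVneq w 0; first by rewrite !sym0r mulr0.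
  have [a [v [a0 Av ->]]] := norm_A w wK w0.
  have := max_v0 v (mem_set Av).
  rewrite {1}/rho ler_pdivrMr ?f_gt0 ?A_n0 // => le_v.
  rewrite lfunZ !symZl !symZr !mulrA.
  have -> : rho v0 * a * a * f (phi v) (phi v) =
    a * a * (rho v0 * f (phi v) (phi v)) by ring.
  by apply: ler_wpM2l => //; rewrite -expr2 sqr_ge0.
split=> // [|w wK]; first exact: phiK.
apply/eqP; rewrite eq_sym -subr_eq0; apply/eqP.
(* In the maximality inequality at [y + t *: w], the terms of order 0 in [t] cancel. *)
apply: (@linear_coeff_eq0 _ _ (rho v0 * f w w - f (h w) w)) => t.
have := max_c (y + t *: w); rewrite memvD ?memvZ // ?phiK// => /(_ isT).
rewrite lfunD lfunZ !symDl !symDr !symZl !symZr (symC f w y).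
rewrite (symC f (h w) y).
have : f (h y) y = rho v0 * f y y by rewrite divfK.
nra.
Qed.

Section Isometry.
Variable h : 'End(V).
Hypothesis h_isom : forall x y, f (h x) (h y) = f x y.

Lemma isometry_inj x : h x = 0 -> x = 0.
Proof. by move=> hx; apply: sym_eq0; rewrite -h_isom hx sym0r. Qed.

Lemma isometry_stable_onto (K : {vspace V}) :
  (h @: K <= K)%VS -> (h @: K)%VS = K.
Proof.
move=> hK; apply/eqP; rewrite eqEdim hK limg_dim_eq ?leqnn //.
apply/eqP; rewrite -subv0; apply/subvP => x; rewrite memv_cap memv_ker memv0.
by case/andP => _ /eqP /isometry_inj ->.
Qed.

(* The vector y maximizing f (h w) w / f w w is an eigenvector of h + h^-1; when
   s <> 0 the plane spanned by y and j is h-stable, and h rotates it. *)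
Lemma rotation_plane (K : {vspace V}) : K != 0%VS -> (h @: K <= K)%VS ->
  exists y j c s, [/\ y \in K, y != 0, h y = c *: y + s *: j,
    h j = c *: j - s *: y & [/\ 0 <= s, c ^+ 2 + s ^+ 2 = 1 &
    {in K, forall w, f (h w) w <= c * f w w}]].
Proof.
move=> K0 hK; have [y [c [yK y0 cy max_c]]] := rayleigh_max h K0.
have hKK w : w \in K -> h w \in K.
  by move=> wK; apply: (subvP hK); exact: memv_img.
(* The first variation at [y] makes the difference [z] orthogonal to [h @: K], which is all of [K]
   and so contains [z]. *)
have hhy : h (h y) = (2 * c) *: h y - y.
  apply/eqP; rewrite -subr_eq0; apply/eqP/sym_eq0.
  set z := (X in f X _ = _).
  have zK : z \in K by rewrite !(memvB, memvZ) // !hKK.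
  have : z \in (h @: K)%VS by rewrite isometry_stable_onto.
  have fz w : w \in K -> f z (h w) = 0.
    move=> wK; rewrite /z !(symDl, symNl, symZl) !h_isom.
    by have := cy w wK; lra.
  by case/memv_imgP => w wK zw; rewrite [X in f _ X]zw fz.
have fhy : f (h y) y = c * f y y by have := cy y yK; rewrite (symC f y); lra.
have fyy := f_gt0 y0.
(* This is the part of [h y] orthogonal to [y]; its length relative to [y] is the sine [s]. *)
have normz : f (h y - c *: y) (h y - c *: y) = (1 - c ^+ 2) * f y y.
  rewrite !(symDl, symDr, symNl, symNr, symZl, symZr) h_isom (symC f y) fhy.
  ring.
have c2 : 0 <= 1 - c ^+ 2 by rewrite -(pmulr_lge0 _ fyy) -normz sym_ge0.
pose s := Num.sqrt (1 - c ^+ 2).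
have s2 : s ^+ 2 = 1 - c ^+ 2 by rewrite sqr_sqrtr.
(* For s = 0 the junk value s^-1 = 0 gives j = 0, consistent with h y = c y. *)
have sj : s *: (s^-1 *: (h y - c *: y)) = h y - c *: y.
  have [s0|s0] := eqVneq s 0; last by rewrite scalerA divff // scale1r.
  by rewrite s0 scale0r; apply/esym/sym_eq0; rewrite normz -s2 s0 expr0n mul0r.
exists y, (s^-1 *: (h y - c *: y)), c, s.
split=> //; first by rewrite sj addrC subrK.
  have [s0|s0] := eqVneq s 0.
    by rewrite s0 invr0 !scale0r linear0 scaler0 subrr.
  have key : h (h y) - c *: h y = c *: (h y - c *: y) - s ^+ 2 *: y.
    rewrite hhy s2 scalerBr scalerA scalerBl scale1r -expr2 opprB addrA addrNK.
    by rewrite mulr_natl mulr2n scalerDl addrAC addrK.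
  apply: (scalerI s0); rewrite lfunZ lfunB lfunZ scalerA divff // scale1r key.
  rewrite [RHS]scalerBr; congr (_ - _); last by rewrite scalerA expr2.
  by rewrite -[in LHS]sj !scalerA; congr (_ *: _); ring.
by split; rewrite ?sqrtr_ge0 // s2 addrC subrK.
Qed.

End Isometry.

End Euclidean.

(** * Brackets, center and invariance of the Killing form *)

Section LieBasics.
Variables (K : fieldType) (g : lieAlgType K).
Implicit Types x y z : g.

Lemma lieDl x y z : lie (x + y) z = lie x z + lie y z.
Proof. by rewrite linearDl. Qed.

Lemma lieDr x y z : lie z (x + y) = lie z x + lie z y.
Proof. by rewrite linearDr. Qed.

Lemma lieNl x z : lie (- x) z = - lie x z.
Proof. by rewrite linearNl. Qed.

Lemma lieNr x z : lie z (- x) = - lie z x.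
Proof. by rewrite linearNr. Qed.

Lemma lieZl a x z : lie (a *: x) z = a *: lie x z.
Proof. by rewrite linearZl_LR. Qed.

Lemma lieZr a x z : lie z (a *: x) = a *: lie z x.
Proof. by rewrite linearZr_LR. Qed.

Lemma lieC x y : lie x y = - lie y x.
Proof.
apply/eqP; rewrite -addr_eq0; apply/eqP.
have := lie_alternating (x + y).
by rewrite lieDl !lieDr !lie_alternating add0r addr0.
Qed.

Lemma lie_lieE x y z : lie (lie x y) z = lie x (lie y z) - lie y (lie x z).
Proof.
have /eqP := lie_jacobi x y z.
rewrite (lieC z (lie x y)) subr_eq0 => /eqP <-.
by rewrite (lieC z x) lieNr.
Qed.

(** A central [x] spans an abelian, hence solvable, ideal. *)
Lemma semisimple_center x : semisimple g -> (forall z, lie x z = 0) -> x = 0.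
Proof.
move=> [_ rad0] xC; have xC' z : lie z x = 0 by rewrite lieC xC oppr0.
apply/eqP; rewrite -memv0 -(rad0 <[x]>%VS) ?memv_line //.
  by move=> z _ /vlineP[a ->]; rewrite lieZr xC' scaler0 mem0v.
exists 1%N; apply/eqP; rewrite -subv0; apply/lie_prodP.
by move=> _ _ /vlineP[a ->] /vlineP[b ->]; rewrite lieZl xC scaler0 mem0v.
Qed.

(** [ad] turns brackets into commutators; the rest is cyclicity of the trace. *)
Lemma killing_invariant : invariant (@killing K g).
Proof.
move=> x y z.
have adB (u v : g) : ad (lie u v) = ((ad u \o ad v) - (ad v \o ad u))%VF.
  apply/lfunP => w; rewrite adE lie_lieE.
  by rewrite add_lfunE opp_lfunE !comp_lfunE !adE.
rewrite /killing !adB !(comp_lfunDl, comp_lfunDr, comp_lfunNl, comp_lfunNr).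
rewrite !linearD !linearN /= opprD opprK addrC !comp_lfunA; congr (_ + _).
by rewrite -comp_lfunA lfun_traceC.
Qed.

End LieBasics.

(** * Isometric automorphisms without nonzero fixed vectors *)

Section FixedPoint.
Variables (R : realType) (g : lieAlgType R) (f : {symmetric g}).
Hypothesis f_gt0 : forall x : g, x != 0 -> 0 < f x x.
Hypothesis f_inv : invariant f.
Variable h : 'End(g).
Hypothesis h_isom : forall x y, f (h x) (h y) = f x y.
Hypothesis h_lie : forall x y, h (lie x y) = lie (h x) (h y).
Hypothesis h_fix : forall x, h x = x -> x = 0.

Lemma fixed_point_free_central : (fullv : {vspace g}) != 0%VS ->
  exists2 a : g, a != 0 & forall z, lie a z = 0.
Proof.
move=> g0.
have [|a [b [c [s [_ a0 ha hb [s0 cs max_c]]]]]] :=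
  rotation_plane f_gt0 h_isom g0; first exact: subvf.
have ab : lie a b = 0.
  apply: h_fix; rewrite h_lie ha hb.
  rewrite !(lieDl, lieDr, lieZl, lieZr, lieNr) !lie_alternating.
  rewrite !(scaler0, oppr0, addr0, add0r).
  rewrite (lieC b a) !scalerN opprK !scalerA -scalerDl -!expr2 cs.
  exact: scale1r.
have c1 : c < 1.
  rewrite lt_neqAle; apply/andP; split; last by nra.
  apply: contraNneq a0 => c1; apply/eqP/h_fix; rewrite ha c1.
  have -> : s = 0 by apply/eqP; rewrite -sqrf_eq0; apply/eqP; nra.
  by rewrite scale1r scale0r addr0.
have comm z : lie a (lie b z) = lie b (lie a z).
  by apply/eqP; rewrite -subr_eq0 -lie_lieE ab linear0l.
pose K := (limg (ad a) + limg (ad b))%VS.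
have aK z : lie a z \in K.
  by apply: (subvP (addvSl _ _)); rewrite -adE memv_img ?memvf.
have bK z : lie b z \in K.
  by apply: (subvP (addvSr _ _)); rewrite -adE memv_img ?memvf.
have hK : (h @: K <= K)%VS.
  apply/subvP => _ /memv_imgP[_ /memv_addP[_ /memv_imgP[p _ ->]
    [_ /memv_imgP[q _ ->] ->]] ->].
  rewrite !adE lfunD !h_lie ha hb !(lieDl, lieZl, lieNl).
  by rewrite !(memvD, memvN, memvZ).
have [K0|K0] := eqVneq K 0%VS.
  by exists a => // z; apply/eqP; rewrite -memv0 -K0.
have [y [j [c' [s' [yK y0 hy hj [s'0 cs' max_c']]]]]] :=
  rotation_plane f_gt0 h_isom K0 hK.
have fyj : 0 < f y y + f j j by rewrite ltr_wpDr ?(sym_ge0 f_gt0) ?f_gt0.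
(* The maximum over all of [g] bounds both [y] and [j]; adding the two inequalities cancels the
   cross terms in [f y j]. *)
have c'c : c' <= c.
  have := max_c y (memvf y); have := max_c j (memvf j).
  rewrite hy hj !(symDl, symNl, symZl) (symC f j y) => H1 H2.
  by rewrite -(ler_pM2r fyj); lra.
(* With c = cos alpha and c' = cos beta, h rotates the pair u, v by the angle
   beta - alpha, whose cosine exceeds the maximal value c'. *)
have [u uE] : exists u, u = lie a y + lie b j by eexists.
have [v vE] : exists v, v = lie a j - lie b y by eexists.
(* Pairing with [z] turns vector identities into scalar ones within reach of [ring]. *)
have ext (w w' : g) : (forall z, f w z = f w' z) -> w = w'.
  move=> ww'; apply/eqP; rewrite -subr_eq0; apply/eqP/(sym_eq0 f_gt0).
  by rewrite symDl symNl ww' subrr.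
have hu : h u = (c * c' + s * s') *: u + (c * s' - s * c') *: v.
  rewrite uE vE !(lfunD, lfunN) !h_lie ha hb hy hj; apply: ext => z.
  rewrite !(lieDl, lieDr, lieNl, lieNr, lieZl, lieZr) !(symDl, symNl, symZl); ring.
have hv : h v = (c * c' + s * s') *: v - (c * s' - s * c') *: u.
  rewrite uE vE !(lfunD, lfunN) !h_lie ha hb hy hj; apply: ext => z.
  rewrite !(lieDl, lieDr, lieNl, lieNr, lieZl, lieZr) !(symDl, symNl, symZl); ring.
have uK : u \in K by rewrite uE memvD.
have vK : v \in K by rewrite vE memvB.
have c'lt : c' < c * c' + s * s'.
  rewrite -subr_gt0.
  have -> : c * c' + s * s' - c' = s * s' - c' * (1 - c) by ring.
  have ss' : 0 <= s * s' by rewrite mulr_ge0.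
  (* If [c' < 0], then [- c' * (1 - c)] is already positive. Otherwise [0 <= c' <= c] gives
     [s <= s'], so [s * s' >= s ^+ 2 = (1 + c) * (1 - c) > c' * (1 - c)]. *)
  have [c'_lt0|c'_ge0] := ltP c' 0; first by nra.
  have le_ss' : s <= s' by rewrite -(@ler_pXn2r _ 2) ?nnegrE //; nra.
  have : s * s <= s * s' by rewrite ler_wpM2l.
  have : c' * (1 - c) < (1 + c) * (1 - c) by rewrite ltr_pM2r; lra.
  by lra.
(* Maximality of [c'] at [u] and at [v], added so that the cross terms cancel, gives
   [d * (f u u + f v v) <= 0] with [d > 0]. *)
have uv0 : f u u + f v v = 0.
  have := max_c' u uK; have := max_c' v vK.
  rewrite hu hv !(symDl, symNl, symZl) (symC f v u) => H1 H2.
  set d := c * c' + s * s' - c'; have d0 : 0 < d by rewrite subr_gt0.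
  apply/eqP; rewrite eq_le addr_ge0 ?(sym_ge0 f_gt0) // andbT.
  by rewrite -(pmulr_rle0 _ d0) /d; lra.
have u0 : u = 0.
  by apply: (sym_eq0 f_gt0); have := sym_ge0 f_gt0 u; have := sym_ge0 f_gt0 v; lra.
have v0 : v = 0.
  by apply: (sym_eq0 f_gt0); have := sym_ge0 f_gt0 u; have := sym_ge0 f_gt0 v; lra.
(* Since [u = v = 0], the sum of the squares of [ad a] and [ad b] kills [y]. Both maps are skew, so
   pairing with [y] gives two squared lengths of sum 0. *)
have [ay0 by0] : lie a y = 0 /\ lie b y = 0.
  have abyy : lie a (lie a y) + lie b (lie b y) = 0.
    have -> : lie a (lie a y) + lie b (lie b y) = lie a u - lie b v.
      by rewrite uE vE !(lieDr, lieNr) opprD opprK comm addrA addrK.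
    by rewrite u0 v0 !linear0r subrr.
  have : f (lie a y) (lie a y) + f (lie b y) (lie b y) = 0.
    by rewrite !f_inv -opprD -symDr abyy sym0r oppr0.
  have := sym_ge0 f_gt0 (lie a y); have := sym_ge0 f_gt0 (lie b y) => H1 H2 H3.
  by split; apply: (sym_eq0 f_gt0); lra.
(* By skewness, a vector killed by [ad a] and [ad b] is orthogonal to [K]; but [y] lies in [K]. *)
case/eqP: y0; apply: (sym_eq0 f_gt0).
case/memv_addP: yK => _ /memv_imgP[p _ ->] [_ /memv_imgP[q _ ->] yE].
by rewrite {1}yE !adE symDl !f_inv ay0 by0 !sym0r oppr0 addr0.
Qed.

End FixedPoint.

(** * Traces of squares of skew endomorphisms *)

Section Trace.
Variables (R : realType) (V : vectType R) (f : {symmetric V}).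
Hypothesis f_gt0 : forall x : V, x != 0 -> 0 < f x x.

(** Gram-Schmidt by induction on the dimension: split off one vector and continue in its orthogonal
    complement in [U]. *)
Lemma orthogonal_basis (U : {vspace V}) :
  exists2 s : seq V, basis_of U s & pairwise (fun u v => f u v == 0) s.
Proof.
have [n] := ubnP (\dim U); elim: n U => // n IHn U ltUn.
have [->|U0] := eqVneq U 0%VS.
  by exists [::] => //; rewrite /basis_of span_nil eqxx nil_free.
pose u := vpick U; have uU : u \in U by exact: memv_pick.
have u0 : u != 0 by rewrite vpick0.
have fuu := f_gt0 u0.
pose W := (U :&: orthov f <[u]>)%VS.
have memW x : x \in W = (x \in U) && (f x u == 0) by rewrite memv_cap mem_orthov1.
have dU : (\dim U = (\dim W).+1)%N.
  rewrite -eq_dim_orthov1 ?prednK // ?lt0n ?dimv_eq0 //.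
  by apply/mem_orthovPn; exists u; rewrite ?gt_eqF.
have [|s sW s_orth] := IHn W; first by rewrite -ltnS -dU.
have sz_s : size s = \dim W.
  by rewrite -(span_basis sW); exact/esym/eqP/(basis_free sW).
have uW : u \notin <<s>>%VS.
  by rewrite (span_basis sW) memW uU /= gt_eqF.
exists (u :: s).
  rewrite basisEfree free_cons uW (basis_free sW) span_cons (span_basis sW).
  by rewrite subv_add -memvE uU capvSl /= dU sz_s.
rewrite pairwise_cons s_orth andbT; apply/allP => x xs.
by have := basis_mem sW xs; rewrite memW symC => /andP[].
Qed.

(** In an orthogonal basis, the diagonal entry of the square at a basis vector [e] is
    [- f (A e) (A e) / f e e]. The trace thus vanishes only if [A] kills the basis. *)
Lemma skew_trace_sqr (A : 'End(V)) : (forall x y, f (A x) y = - f x (A y)) ->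
  lfun_trace (A \o A)%VF <= 0 /\ (lfun_trace (A \o A)%VF = 0 -> A = 0).
Proof.
move=> skA; have [s sB s_orth] := orthogonal_basis fullv.
have szs : size s == \dim {:V}.
  by rewrite -(span_basis sB) eq_sym; exact: basis_free sB.
pose e : (\dim {:V}).-tuple V := Tuple szs.
have eB : basis_of {:V} e by [].
have e_gt0 (i : 'I_(\dim {:V})) : 0 < f e`_i e`_i.
  by apply: f_gt0; rewrite (basis_not0 eB) // mem_nth // size_tuple.
have e_orth (i j : 'I_(\dim {:V})) : i != j -> f e`_i e`_j = 0.
  have /pairwiseP-/(_ 0) e2 := s_orth.
  have lt k : (k < \dim {:V})%N -> k \in [pred k | (k < size s)%N].
    by rewrite inE (eqP szs).
  rewrite neq_ltn => /orP[]; first by move=> ij; apply/eqP/e2; rewrite ?lt.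
  by move=> ij; rewrite symC; apply/eqP/e2; rewrite ?lt.
have coordE i x : coord e i x = f x e`_i / f e`_i e`_i.
  apply: (canRL (mulfK _)); first by rewrite gt_eqF.
  rewrite [in RHS](coord_basis eB (memvf x)) sym_suml (bigD1 i) //=.
  rewrite big1 ?addr0 ?symZl //.
  by move=> j ji; rewrite symZl e_orth ?mulr0.
have trE : lfun_trace (A \o A)%VF =
    - \sum_(i < \dim {:V}) f (A e`_i) (A e`_i) / f e`_i e`_i.
  rewrite (lfun_trace_basis _ eB) -sumrN; apply: eq_bigr => i _.
  rewrite !mxE /= passmx.vecof_delta coordE comp_lfunE skA.
  exact: mulNr.
have ge0 (i : 'I_(\dim {:V})) : 0 <= f (A e`_i) (A e`_i) / f e`_i e`_i.
  by rewrite divr_ge0 ?(sym_ge0 f_gt0) // ltW.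
split; first by rewrite trE oppr_le0 sumr_ge0.
rewrite trE => /eqP; rewrite oppr_eq0 psumr_eq0 // => /allP A0.
apply/lfunP => x; rewrite (coord_basis eB (memvf x)) lfunE /= linear_sum.
apply: big1 => i _ /=; rewrite lfunZ.
have := A0 i; rewrite mem_index_enum => /(_ isT).
rewrite mulf_eq0 invr_eq0 (gt_eqF (e_gt0 i)) orbF => /eqP.
move=> /(sym_eq0 f_gt0) Ae; rewrite [A _]Ae.
by rewrite scaler0.
Qed.

End Trace.

(** * Definiteness of the Killing form *)

Section Compact.
Variables (R : realType) (g : lieAlgType R).
Hypotheses (g_compact : compact_lie g) (g_ss : semisimple g).

(** [ad x] is skew for the invariant inner product; if its square had trace 0, [x] would be
    central. *)
Lemma killing_lt0 (x : g) : x != 0 -> killing x x < 0.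
Proof.
move=> x0; have [f f_inv] := g_compact.
have f_gt0 (y : g) : y != 0 -> 0 < f y y.
  exact: (@neq0_dnorm_gt0 _ _ _ f).
have [|le0 eq0] := @skew_trace_sqr _ _ f f_gt0 (ad x) _.
  by move=> y z; rewrite !adE; exact: f_inv.
rewrite lt_neqAle le0 andbT; apply: contraNneq x0 => /eq0 adx.
by apply/eqP/semisimple_center => // z; rewrite -adE adx lfunE.
Qed.

End Compact.

(** * Dirac complements of the diagonal as graphs *)

Theorem corollary6p10 (R : realType) (g : lieAlgType R) :
  compact_lie g -> semisimple g ->
  ~ exists M : {vspace g * g},
      dirac_complement (double_pairing g) (diagonal g) M.
Proof.
move=> g_compact g_ss [M [[M_sub M_lag] DM_direct DM_full]].
have B_lt0 (x : g) : x != 0 -> killing x x < 0 by exact: killing_lt0.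
have M_iso u v : u \in M -> v \in M -> killing u.1 v.1 = killing u.2 v.2.
  rewrite {1}M_lag => /mem_orthovP uM vM; apply/eqP; rewrite -subr_eq0; apply/eqP.
  exact: uM v vM.
have M_diag u : u \in M -> u.1 = u.2 -> u = 0.
  move=> uM u12; apply/eqP; rewrite -memv0 -(directv_addP DM_direct).
  by rewrite memv_cap uM mem_diagonal u12 eqxx.
have M_inj u : u \in M -> u.1 = 0 -> u = 0.
  move=> uM u1; apply: M_diag => //; rewrite u1.
  have := M_iso u u uM uM; rewrite u1 linear0l => B0.
  by have [->//|/B_lt0] := eqVneq u.2 0; rewrite -B0 ltxx.
pose p1 : 'Hom((g * g)%type, g) := linfun fst.
pose p2 : 'Hom((g * g)%type, g) := linfun snd.
have M_onto : (p1 @: M)%VS = fullv.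
  apply/eqP; rewrite eqEdim subvf limg_dim_eq.
    (* The diagonal has at most the dimension of [g], so its complement [M] has at least that
       dimension, and [p1] is injective on [M]. *)
    have dD : (\dim (diagonal g) <= \dim {:g})%N.
      by rewrite -(limg_ker_dim (linfun (fun x : g => (x, x)))) leq_addl.
    have : \dim (diagonal g + M)%VS = (\dim {:g} + \dim {:g})%N.
      by rewrite DM_full !dimvf.
    rewrite (directvP DM_direct) /= => dE.
    by rewrite -(leq_add2l (\dim {:g})) -dE leq_add2r.
  apply/eqP; rewrite -subv0; apply/subvP => u; rewrite memv_cap memv_ker memv0.
  case/andP => uM; rewrite lfunE => /eqP u1; apply/eqP; exact: M_inj.
(* [q] extends [p1] from [M] to the whole space and is onto, so [q^-1] is a right inverse; [h x] is
   the second coordinate of the point of [M] above [x]. *)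
pose q := (p1 \o projv M)%VF.
pose h : 'End(g) := (p2 \o projv M \o q^-1)%VF.
have hM x : (x, h x) \in M.
  have : q (q^-1%VF x) = x.
    by apply: limg_lfunVK; rewrite limg_comp limg_proj M_onto memvf.
  rewrite /h /q !comp_lfunE; set w := projv M _ => p1w.
  suff -> : (x, p2 w) = w by exact: memv_proj.
  by rewrite -p1w !lfunE; case: (w).
have h_uniq x y : (x, y) \in M -> h x = y.
  move=> xyM; have /(congr1 snd) := M_inj _ (memvB (hM x) xyM) (subrr x).
  by move=> /= /eqP; rewrite subr_eq0 => /eqP.
pose f := opp_form (@killing R g) : {symmetric g}.
have f_gt0 (x : g) : x != 0 -> 0 < f x x.
  by move=> /B_lt0; rewrite /f /= /opp_form oppr_gt0.
have f_inv : invariant f.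
  by move=> x y z; congr (- _); exact: killing_invariant.
have h_isom x y : f (h x) (h y) = f x y.
  by congr (- _); exact/esym/(M_iso _ _ (hM x) (hM y)).
have h_lie x y : h (lie x y) = lie (h x) (h y).
  by apply: h_uniq; exact: (M_sub _ _ (hM x) (hM y)).
have h_fix x : h x = x -> x = 0.
  by move=> hx; have [] := M_diag _ (hM x) (esym hx).
have [a a0 aC] : exists2 a : g, a != 0 & forall z, lie a z = 0.
  apply: (fixed_point_free_central f_gt0 f_inv h_isom h_lie h_fix).
  by apply/eqP; case: g_ss.
by case/eqP: a0; exact: semisimple_center.
Qed.
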